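(* $\limsup_{n\to\infty} \nu(n)=\infty$.
   Context: Let $F(x,y,z)=x^3+y^3+z^3-3xyz$. For a positive integer $n$, $\nu(n)$ denotes the number of triples of integers $(x,y,z)$ with $0\leq x\leq y\leq z$ and $z\geq x+1$ such that $F(x,y,z)=n$. *)

(* Defs.v *)
From mathcomp Require Import all_boot all_order all_algebra.
From mathcomp Require Import zify ring lra.
From mathcomp Require Import finmap.
From mathcomp Require Import all_classical all_reals all_analysis.

Set Implicit Arguments.
Unset Strict Implicit.
Unset Printing Implicit Defensive.

Import Order.TTheory GRing.Theory Num.Theory.

Local Open Scope classical_set_scope.
Local Open Scope ring_scope.

Definition F (x y z : int) : int :=
  x ^+ 3 + y ^+ 3 + z ^+ 3 - 3 * x * y * z.

Definition nu_set (n : nat) : set (int * int * int) :=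
  [set t | let: (x, y, z) := t in
    [/\ 0 <= x, x <= y, y <= z, x + 1 <= z & F x y z = n%:Z]].

(* [fset_set] returns the empty set on infinite sets; [finite_nu_set] shows
   that this default value never occurs in [nu]. *)
Definition nu (n : nat) : nat := #|` fset_set (nu_set n)|%N.

Lemma finite_nu_set (n : nat) : finite_set (nu_set n).
Proof.
pose e (t : nat * nat * nat) : int * int * int :=
  (t.1.1%:Z, t.1.2%:Z, t.2%:Z).
apply: (@sub_finite_set _ _ (e @` (`I_n.+1 `*` `I_n.+1 `*` `I_n.+1))); last first.
  by apply: finite_image; do 2?apply: finite_setX; apply: finite_II.
move=> [[x y] z] /= [x0 xy yz xz Fn].
have zn : z <= n%:Z.
  rewrite -Fn /F.
  have [a [b [a0 b0 ya zb]]] : exists a b : int,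
      [/\ 0 <= a, 0 <= b, y = x + a & z = x + a + b].
    by exists (y - x), (z - y); split; lia.
  have q1 : 1 <= a * a + a * b + b * b by nia.
  have -> : x ^+ 3 + y ^+ 3 + z ^+ 3 - 3 * x * y * z =
      (x + y + z) * (a * a + a * b + b * b) by rewrite zb ya; ring.
  by nia.
by exists (`|x|, `|y|, `|z|)%N; [repeat split => /=; lia|rewrite /e /=; congr (_, _, _); lia].
Qed.

(* Main.v *)
(* F(x, x+k, x+2k) = 9k^2(x+k), so n = 9M is represented by the progression with
   difference k as soon as k^2 divides M and k^3 <= M.  For M a multiple of
   (K!)^3 this holds for k = 1, ..., K. *)
Require Import Defs.
From mathcomp Require Import all_boot all_order all_algebra.
From mathcomp Require Import zify ring.
From mathcomp Require Import all_classical all_reals all_analysis.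

Set Implicit Arguments.
Unset Strict Implicit.
Unset Printing Implicit Defensive.

Import Order.TTheory GRing.Theory Num.Theory.

(** Choose middle term [M / k^2] in the progression of difference [k]: the value of [F] is then
    [9 * M], whatever [k] is. Taking [M] a positive multiple of [K!^3] admits every [k] from 1 to
    [K], so [nu (9 * M)] is at least [K] for arbitrarily large [M]. *)

Lemma F_progression (x k : int) :
  (F x (x + k) (x + 2 * k) = 9 * k ^+ 2 * (x + k))%R.
Proof. by rewrite /F; ring. Qed.

Lemma leq_nu (n : nat) (s : seq (int * int * int)) :
  uniq s -> (forall t, t \in s -> nu_set n t) -> size s <= nu n.
Proof.
move=> us sn; rewrite /nu; apply: uniq_leq_size => // t /sn nt.
by rewrite in_fset_set ?inE//; exact: finite_nu_set.
Qed.

Lemma nu_progression (M k : nat) : 0 < k -> k ^ 2 %| M -> k ^ 3 <= M ->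
  let x : int := ((M %/ k ^ 2)%:Z - k%:Z)%R in
  nu_set (9 * M) (x, x + k%:Z, x + 2 * k%:Z)%R.
Proof.
move=> k0 /dvdnP[q ->]; rewrite mulnK ?expn_gt0 ?k0// expnS leq_pmul2r ?expn_gt0 ?k0//.
(* With [M = q * k^2], the bound [k^3 <= M] has become [k <= q], so [x = q - k] is nonnegative. *)
move=> kq /=; split; [lia|lia|lia|lia|].
by rewrite F_progression subrK; lia.
Qed.

Lemma leq_nu_fact (K m : nat) : 0 < m -> K <= nu (9 * (K`! ^ 3 * m)).
Proof.
move=> m0; set M := K`! ^ 3 * m.
pose e (k : nat) : int * int * int :=
  let x : int := ((M %/ k ^ 2)%:Z - k%:Z)%R in (x, x + k%:Z, x + 2 * k%:Z)%R.
rewrite -[leqLHS](size_iota 1) -(size_map e); apply: leq_nu.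
  (* The first two entries of the triple determine the difference [k]. *)
  by rewrite map_inj_uniq ?iota_uniq// => i j [] -> /addrI [].
move=> _ /mapP[k + ->]; rewrite mem_iota add1n ltnS => /andP[k0 kK].
have kF : k %| K`! by rewrite dvdn_fact // k0.
apply: nu_progression => //.
  by rewrite dvdn_mulr// (dvdn_trans (dvdn_exp2r 2 kF))// dvdn_exp2l.
(* The size bound comes from divisibility: [k^3] divides the positive number [M]. *)
by rewrite dvdn_leq ?muln_gt0 ?expn_gt0 ?fact_gt0// dvdn_mulr// dvdn_exp2r.
Qed.

(** The limsup is an infimum of suprema over neighbourhoods of infinity; each contains a tail, on
    which [u] exceeds any real [r]. *)
Lemma limn_esup_unbounded (R : realType) (u : nat -> nat) :
  (forall K N, exists2 n, N <= n & K <= u n) ->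
  limn_esup (fun n : nat => ((u n)%:R : R)%:E%E) = +oo%E.
Proof.
move=> unb; rewrite /limn_esup /limf_esup.
apply/ereal_inf_pinfty => _ [A [N _ NA] <-].
apply/eqyP => r r0.
have [n Nn Kn] := unb (Num.truncn r).+1 N.
apply: (@le_trans _ _ ((u n)%:R)%:E); last first.
  by apply: ereal_sup_ubound; exists n => //; exact: NA.
by rewrite lee_fin (le_trans (ltW (truncnS_gt r)))// ler_nat.
Qed.

Theorem proposition5 (R : realType) :
  limn_esup (fun n : nat => ((nu n)%:R : R)%:E%E) = +oo%E.
Proof.
apply: limn_esup_unbounded => K N.
(* The factor [N.+1] is positive and pushes the witness beyond [N]. *)
exists (9 * (K`! ^ 3 * N.+1)); last exact: leq_nu_fact.
have : 0 < K`! ^ 3 by rewrite expn_gt0 fact_gt0.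
by nia.
Qed.
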